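(* Let $(\mathbb D^2,\mathcal F)$ be the Funk surface, i.e. $\mathbb D^2=\{x\in\mathbb R^2:|x|<1\}$ with the Finsler function $$\mathcal F(x,y)=\frac{\sqrt{|y|^2-\left(|x|^2|y|^2-\langle x,y\rangle^2\right)}+\langle x,y\rangle}{1-|x|^2}.$$ Identify its indicatrix at $0\in\mathbb D^2$, which is the unit circle $\{y\in T_0\mathbb D^2:|y|=1\}$, with $S^1$, with angular coordinate $t$ given by $y=(\cos t,\sin t)$. Then the infinitesimal holonomy algebra $\mathfrak{hol}^{*}(0)$ of the Funk surface at $0$ contains the real Witt algebra, that is, the Lie algebra of vector fields on $S^1$ linearly generated over $\mathbb R$ by $\cos nt\,\frac{\partial}{\partial t}$ and $\sin nt\,\frac{\partial}{\partial t}$, $n=0,1,2,\dots$.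
   Context: For a Finsler manifold $(M,\mathcal F)$, $g_{ij}(x,y)=\frac12\frac{\partial^2\mathcal F^2}{\partial y^i\partial y^j}(x,y)$, $G^i(x,y)=\frac14 g^{il}\big(2\frac{\partial g_{jl}}{\partial x^k}-\frac{\partial g_{jk}}{\partial x^l}\big)y^jy^k$ and $G^i_j=\frac{\partial G^i}{\partial y^j}$. The indicatrix at $x$ is $\mathcal I_xM=\{y\in T_xM:\mathcal F(x,y)=1\}$ and $\mathcal IM$ is the indicatrix bundle. The horizontal lift of $X=X^i\frac{\partial}{\partial x^i}$ is $X^h=X^i\big(\frac{\partial}{\partial x^i}-G^k_i(x,y)\frac{\partial}{\partial y^k}\big)$. The horizontal lifts span $\mathcal HTM$, $\mathcal VTM=\mathrm{Ker}\,\pi_*$ is the vertical distribution ($\pi:TM\to M$), and $v$ is the projection of $TTM=\mathcal HTM\oplus\mathcal VTM$ onto $\mathcal VTM$. The curvature is $R_{(x,y)}(X,Y)=v[X^h,Y^h]$. The horizontal Berwald covariant derivative of a vertical vector field $\xi$ by $X\in\mathfrak X^\infty(M)$ is $\nabla_X\xi=[X^h,\xi]$. A curvature vector field is a vector field $\xi=r(X,Y)$ on $\mathcal IM$ with $X,Y\in\mathfrak X^\infty(M)$, $r(X,Y)(x,y)=R_{(x,y)}(X_x,Y_x)$. $\mathfrak{hol}^{*}(M)$ is the smallest Lie algebra of vector fields on $\mathcal IM$ which contains all curvature vector fields, is closed under the Lie bracket, and satisfies $\nabla_X\xi\in\mathfrak{hol}^{*}(M)$ whenever $\xi\in\mathfrak{hol}^{*}(M)$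 and $X\in\mathfrak X^\infty(M)$. The infinitesimal holonomy algebra at $x$ is $\mathfrak{hol}^{*}(x)=\{\xi|_{\mathcal I_xM}:\xi\in\mathfrak{hol}^{*}(M)\}\subset\mathfrak X^\infty(\mathcal I_xM)$. *)

(* Defs.v *)
From HB Require Import structures.
From mathcomp Require Import all_boot all_order all_algebra.
From mathcomp Require Import all_classical all_reals all_analysis.

Set Implicit Arguments.
Unset Strict Implicit.
Unset Printing Implicit Defensive.

Import Order.TTheory GRing.Theory Num.Theory.
Import numFieldNormedType.Exports.

Local Open Scope classical_set_scope.
Local Open Scope ring_scope.

Section Smooth.
Context {R : realType} {V W : normedModType R}.

(* [V] is finite-dimensional in all uses below, so that requiring C^k of the
   directional derivatives along all constant vectors gives the usual C^{k+1}. *)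
Fixpoint Ck (k : nat) (U : set V) (f : V -> W) : Prop :=
  if k is k'.+1 then
    (forall x, U x -> differentiable f x) /\ (forall v, Ck k' U ('D_v f))
  else forall x, U x -> {for x, continuous f}.

Definition smooth_on (U : set V) (f : V -> W) : Prop := forall k, Ck k U f.

Definition lie_bracket (X Y : V -> V) : V -> V :=
  fun p => 'D_(X p) Y p - 'D_(Y p) X p.

End Smooth.

(* [M] is an open subset of R^n with its global chart; TM is M x R^n, a point
   of it is a pair (x, y), and a tangent vector (a, b) to TM at (x, y) stands
   for a^i d/dx^i + b^i d/dy^i.  A Finsler function is only smooth away from
   the zero section, so all objects are considered on the slit tangent bundle,
   where total functions have meaningful values. *)
Section Finsler.
Context {R : realType} {n : nat}.
Local Notation E := 'rV[R]_n.
Local Notation TE := ('rV[R]_n * 'rV[R]_n)%type.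

Definition ddx (W : normedModType R) (i : 'I_n) (f : TE -> W) : TE -> W :=
  'D_((delta_mx 0 i : E, 0 : E) : TE) f.

Definition ddy (W : normedModType R) (i : 'I_n) (f : TE -> W) : TE -> W :=
  'D_((0 : E, delta_mx 0 i : E) : TE) f.

Variables (M : set E) (F : TE -> R).

Definition slit_tangent_bundle : set TE := [set p | M p.1 /\ p.2 != 0].

Definition indicatrix_bundle : set TE := [set p | M p.1 /\ F p = 1].

Definition indicatrix (x : E) : set E := [set y | F (x, y) = 1].

Definition metric_coef (i j : 'I_n) : TE -> R :=
  fun p => 2^-1 * ddy i (ddy j (fun q => F q ^+ 2)) p.

Definition metric (p : TE) : 'M[R]_n := \matrix_(i, j) metric_coef i j p.

Definition spray_coef (i : 'I_n) : TE -> R := fun p =>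
  4^-1 * \sum_(l < n) \sum_(j < n) \sum_(k < n)
    invmx (metric p) i l *
    (2 * ddx k (metric_coef j l) p - ddx l (metric_coef j k) p) *
    p.2 0 j * p.2 0 k.

(* G^i_j *)
Definition connection_coef (i j : 'I_n) : TE -> R := ddy j (spray_coef i).

(* (X^i G^k_i)_k *)
Definition connection_map (p : TE) (X : E) : E :=
  \row_(k < n) \sum_(i < n) X 0 i * connection_coef k i p.

Definition horizontal_lift (X : E -> E) : TE -> TE :=
  fun p => (X p.1, - connection_map p (X p.1)).

(* The projection onto the vertical part along the horizontal distribution:
   (a, b) = (a, - N a) + (0, b + N a). *)
Definition vertical_proj (p : TE) (w : TE) : TE :=
  (0, w.2 + connection_map p w.1).

(* r(X, Y), as a vector field on the slit tangent bundle. *)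
Definition curvature_field (X Y : E -> E) : TE -> TE := fun p =>
  vertical_proj p (lie_bracket (horizontal_lift X) (horizontal_lift Y) p).

Definition berwald (X : E -> E) (xi : TE -> TE) : TE -> TE :=
  lie_bracket (horizontal_lift X) xi.

(* A vector field on the indicatrix bundle IM is represented by a smooth
   vector field on the slit tangent bundle that is tangent to IM, and two such
   fields represent the same one iff they agree on IM.  Every smooth field on
   the hypersurface IM has such a representative (extend by the dilations
   (x, y) |-> (x, c y)), and brackets of representatives restrict on IM to the
   bracket of the represented fields. *)
Definition indicatrix_field (xi : TE -> TE) : Prop :=
  smooth_on slit_tangent_bundle xi /\
  forall p, indicatrix_bundle p -> 'D_(xi p) F p = 0.

(* hol^*(M), as the set of all representatives of its elements.  Curvature
   fields and horizontal lifts are smooth and tangent to IM, so the generators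
   need no such side condition; [hol_eq] does, because an arbitrary function
   agreeing with [xi] on IM has no meaningful bracket. *)
Inductive hol_star : (TE -> TE) -> Prop :=
| hol_curvature X Y : smooth_on M X -> smooth_on M Y ->
    hol_star (curvature_field X Y)
| hol_zero : hol_star (fun=> 0)
| hol_add xi eta : hol_star xi -> hol_star eta ->
    hol_star (fun p => xi p + eta p)
| hol_scale (c : R) xi : hol_star xi -> hol_star (fun p => c *: xi p)
| hol_bracket xi eta : hol_star xi -> hol_star eta ->
    hol_star (lie_bracket xi eta)
| hol_berwald X xi : smooth_on M X -> hol_star xi -> hol_star (berwald X xi)
| hol_eq xi eta : hol_star xi -> indicatrix_field eta ->
    (forall p, indicatrix_bundle p -> xi p = eta p) -> hol_star eta.

(* hol^*(x): the vector field on the indicatrix at [x] is given by its values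
   in T_x M (only the values on the indicatrix matter). *)
Definition hol_star_at (x : E) (eta : E -> E) : Prop :=
  exists2 xi, hol_star xi &
    forall y, indicatrix x y -> xi (x, y) = (0, eta y).

End Finsler.

Section Funk.
Context {R : realType} {n : nat}.

(* The library norm on row vectors is the sup norm, hence the explicit
   Euclidean structure. *)
Definition edot (u v : 'rV[R]_n) : R := \sum_(i < n) u 0 i * v 0 i.

Definition enorm (u : 'rV[R]_n) : R := Num.sqrt (edot u u).

Definition unit_ball : set 'rV[R]_n := [set x | enorm x < 1].

Definition funk (p : 'rV[R]_n * 'rV[R]_n) : R :=
  let: (x, y) := p in
  (Num.sqrt (enorm y ^+ 2 - (enorm x ^+ 2 * enorm y ^+ 2 - edot x y ^+ 2))
   + edot x y) / (1 - enorm x ^+ 2).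

End Funk.

Section Witt.
Context {R : realType}.

(* [f] stands for the vector field f(t) d/dt on S^1. *)
Definition witt_algebra (f : R -> R) : Prop :=
  exists (N : nat) (a b : nat -> R),
    f = fun t => \sum_(k < N) (a k * cos (k%:R * t) + b k * sin (k%:R * t)).

Definition circle_point (t : R) : 'rV[R]_2 :=
  \row_(i < 2) if i == 0 then cos t else sin t.

(* d/dt at [circle_point t] *)
Definition circle_tangent (t : R) : 'rV[R]_2 :=
  \row_(i < 2) if i == 0 then - sin t else cos t.

End Witt.

(* Main.v *)
(* In the coordinates (x, t, F) of the slit tangent bundle, where
   u = (cos t, sin t) = x + y / F(x, y) is the point at which the ray from x in
   direction y leaves the disk, F is a first integral of the horizontal lifts:
     X^h = X + a_X d/dt,
     a_X = (X_1 (x_2 - sin t) + X_2 (cos t - x_1)) / (2 D),  D = 1 - <x, u>.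
   The curvature field of the constant fields e_1, e_2 is -1/(4 D) d/dt, and
     nabla_X (phi d/dt) = (X^h phi - phi d(a_X)/dt) d/dt.
   Over x = 0 the curvature, its first derivatives and two of its second
   derivatives are proportional to d/dt, cos t d/dt, sin t d/dt,
   (3/2 + cos 2t) d/dt and sin 2t d/dt.  Bracketing with cos t d/dt turns the
   modes n - 1 and n into the mode n + 1 for n >= 2, so these five fields
   generate the Witt algebra. *)
Require Import Defs.
From HB Require Import structures.
From mathcomp Require Import all_boot all_order all_algebra.
From mathcomp Require Import all_classical all_reals all_analysis.
From mathcomp Require Import ring lra.
Import Order.TTheory GRing.Theory Num.Theory.
Import numFieldNormedType.Exports.
Local Open Scope classical_set_scope.
Local Open Scope ring_scope.

Set Implicit Arguments.
Unset Strict Implicit.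

(** * Directional derivatives *)

(** A directional derivative only sees the restriction to a line, so the one-variable chain rule
    (for [sqrt] and [atan] below) becomes applicable. *)
Lemma is_derive_line (R : realType) (V W : normedModType R) (f : V -> W)
    (p v : V) (df : W) :
  is_derive p v f df <-> is_derive (0 : R) 1 (fun h : R => f (h *: v + p)) df.
Proof.
have E : 'D_v f p = 'D_1 (fun h : R => f (h *: v + p)) (0 : R).
  rewrite /derive; set g1 := fun h => h^-1 *: _; set g2 := fun h => h^-1 *: _.
  suff -> : g1 = g2 by [].
  by apply/funext => h; rewrite /g1 /g2 /= addr0 scale0r add0r [_%:A]mulr1.
by split=> -[fd <-]; apply: DeriveDef; rewrite ?E //;
  [exact: (derivable1P _ _ _).1 | exact: (derivable1P _ _ _).2].
Qed.

Section DirectionalDerivatives.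
Context {R : realType} {V : normedModType R}.
Implicit Types (p v : V).

Lemma is_derive_pair (W W' : normedModType R) (f : V -> W) (g : V -> W') p v df dg :
  is_derive p v f df -> is_derive p v g dg ->
  is_derive p v (fun q => (f q, g q)) (df, dg).
Proof.
move=> [fd <-] [gd <-].
have fgd : (fun h => h^-1 *: ((f (h *: v + p), g (h *: v + p)) - (f p, g p)))
    @ 0^' --> ('D_v f p, 'D_v g p) by exact: (cvg_pair fd gd).
by apply: DeriveDef; [apply/cvg_ex; eexists; exact: fgd | exact: cvg_lim fgd].
Qed.

Lemma is_derive_row n (f : V -> 'I_n -> R) p v (df : 'I_n -> R) :
  (forall i, is_derive p v (f^~ i) (df i)) ->
  is_derive p v (fun q => \row_i f q i) (\row_i df i).
Proof.
move=> fd.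
have dM : derivable (fun q => \row_i f q i) p v.
  apply/derivable_mxP => i j.
  under eq_fun do rewrite mxE; exact: ex_derive.
apply: DeriveDef => //; rewrite derive_mx //.
apply/rowP => j; rewrite !mxE.
by under eq_fun do rewrite mxE; exact: derive_val.
Qed.

Lemma is_deriveV_fun (f : V -> R) p v (df : R) :
  f p != 0 -> is_derive p v f df ->
  is_derive p v (fun q => (f q)^-1) (- df / f p ^+ 2).
Proof.
move=> f0 [fd <-]; apply: DeriveDef; first exact: derivableV.
by rewrite deriveV // /GRing.scale /= mulNr mulrC mulNr.
Qed.

Lemma is_derive_sqrt_fun (f : V -> R) p v (df : R) :
  0 < f p -> is_derive p v f df ->
  is_derive p v (fun q => Num.sqrt (f q)) (df / (2 * Num.sqrt (f p))).
Proof.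
move=> f0 fd; apply/(@is_derive_line R V R).
move/(@is_derive_line R V R) : fd => fd.
set g := (fun h : R => f (h *: v + p)) in fd *.
have g0 : g 0 = f p by rewrite /g scale0r add0r.
have sd : is_derive (g 0) 1 Num.sqrt (2 * Num.sqrt (g 0))^-1.
  by apply: is_derive1_sqrt; rewrite g0.
by have := is_derive1_comp sd fd; rewrite g0 mulrC.
Qed.

Lemma is_deriveD_fun (f g : V -> R) p v (df dg : R) :
  is_derive p v f df -> is_derive p v g dg ->
  is_derive p v (fun q => f q + g q) (df + dg).
Proof. exact: is_deriveD. Qed.

Lemma is_deriveN_fun (f : V -> R) p v (df : R) :
  is_derive p v f df -> is_derive p v (fun q => - f q) (- df).
Proof. exact: is_deriveN. Qed.

Lemma is_deriveM_fun (f g : V -> R) p v (df dg : R) :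
  is_derive p v f df -> is_derive p v g dg ->
  is_derive p v (fun q => f q * g q) (f p * dg + g p * df).
Proof. exact: is_deriveM. Qed.

Lemma is_derive_sqr_fun (f : V -> R) p v (df : R) :
  is_derive p v f df -> is_derive p v (fun q => f q ^+ 2) (2 * f p * df).
Proof.
move=> fd; under eq_fun do rewrite expr2.
by apply: is_derive_eq (is_deriveM_fun fd fd) _; ring.
Qed.

End DirectionalDerivatives.

Lemma is_derive_linear_form (R : realType) (V : normedModType R) (f : V -> R)
    (p v : V) :
  (forall a x y, f (a *: x + y) = a * f x + f y) -> is_derive p v f (f v).
Proof.
move=> flin; apply/(@is_derive_line R V R).
have -> : (fun h : R => f (h *: v + p)) = (fun h => h * f v + f p).
  by apply/funext => h; rewrite flin.
have hd := is_deriveM_fun (is_derive_id (0 : R) 1)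
  (is_derive_cst (f v) (0 : R) 1).
apply: is_derive_eq (is_deriveD_fun hd (is_derive_cst (f p) (0 : R) 1)) _.
by rewrite mul0r add0r addr0 mulr1.
Qed.

Section Coordinates.
Context {R : realType} {n : nat}.
Local Notation TE := ('rV[R]_n * 'rV[R]_n)%type.
Implicit Types (p v : TE).

Lemma is_derive_base_coord i p v :
  is_derive p v (fun q : TE => q.1 0 i) (v.1 0 i).
Proof.
by apply: (is_derive_linear_form (f := fun q : TE => q.1 0 i)) => *; rewrite !mxE.
Qed.

Lemma is_derive_fibre_coord i p v :
  is_derive p v (fun q : TE => q.2 0 i) (v.2 0 i).
Proof.
by apply: (is_derive_linear_form (f := fun q : TE => q.2 0 i)) => *; rewrite !mxE.
Qed.

End Coordinates.

(** Differentiation guided by the shape of the expression: derivatives of named functions are taken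
    from the context, and each inverse leaves the goal that its argument does not vanish. *)
Ltac derive_rules :=
  lazymatch goal with
  | |- is_derive _ _ (fun _ => ?a) _ => notypeclasses refine (is_derive_cst a _ _)
  | |- is_derive _ _ (fun q => q) _ => notypeclasses refine (is_derive_id _ _)
  | |- is_derive _ _ (fun q => fun_of_matrix (fst q) _ _) _ =>
      notypeclasses refine (is_derive_base_coord _ _ _)
  | |- is_derive _ _ (fun q => fun_of_matrix (snd q) _ _) _ =>
      notypeclasses refine (is_derive_fibre_coord _ _ _)
  | |- is_derive _ _ (fun q => @?f q + @?g q) _ =>
      notypeclasses refine (is_deriveD_fun _ _); derive_rules
  | |- is_derive _ _ (fun q => - @?f q) _ =>
      notypeclasses refine (is_deriveN_fun _); derive_rules
  | |- is_derive _ _ (fun q => @?f q * @?g q) _ =>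
      notypeclasses refine (is_deriveM_fun _ _); derive_rules
  | |- is_derive _ _ (fun q => @?f q ^+ 2) _ =>
      notypeclasses refine (is_derive_sqr_fun _); derive_rules
  | |- is_derive _ _ (fun q => (@?f q)^-1) _ =>
      notypeclasses refine (is_deriveV_fun _ _); [ | derive_rules]
  | |- _ => try eassumption
  end.

Ltac derive :=
  notypeclasses refine (is_derive_eq _ _); [derive_rules | cbv beta].

(** * The Funk function and its exit point *)

Section FunkSurface.
Context {R : realType}.
Local Notation E := 'rV[R]_2.
Local Notation TE := ('rV[R]_2 * 'rV[R]_2)%type.
Implicit Types (p v : TE) (x y X : E) (r t k a : R).

Local Notation F := (@funk R 2).
Local Notation S := (slit_tangent_bundle (@unit_ball R 2)).

Lemma ord2_cases (i : 'I_2) : i = 0 \/ i = 1.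
Proof. by case: i => [[|[|//]] lti]; [left | right]; apply/val_inj. Qed.

Lemma sum_ord2 (f : 'I_2 -> R) : \sum_(i < 2) f i = f 0 + f 1.
Proof.
rewrite !big_ord_recl big_ord0 addr0.
by rewrite (_ : lift ord0 ord0 = 1 :> 'I_2) //; exact/val_inj.
Qed.

Lemma edotE x y : edot x y = x 0 0 * y 0 0 + x 0 1 * y 0 1.
Proof. exact: sum_ord2. Qed.

Lemma enorm_sqr x : enorm x ^+ 2 = x 0 0 ^+ 2 + x 0 1 ^+ 2.
Proof.
by rewrite /enorm sqr_sqrtr edotE ?addr_ge0 // -?expr2 ?sqr_ge0.
Qed.

Lemma unit_ballE x : unit_ball x <-> x 0 0 ^+ 2 + x 0 1 ^+ 2 < 1.
Proof.
by rewrite -enorm_sqr /unit_ball /= expr_lt1 ?sqrtr_ge0.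
Qed.

(** The radicand of the Funk function, rewritten by Lagrange's identity $|x|^2|y|^2-\langle
    x,y\rangle^2=(x_1y_2-x_2y_1)^2$. *)
Definition funk_disc p : R :=
  p.2 0 0 ^+ 2 + p.2 0 1 ^+ 2 - (p.1 0 0 * p.2 0 1 - p.1 0 1 * p.2 0 0) ^+ 2.

Lemma funkE p : F p =
  (Num.sqrt (funk_disc p) + (p.1 0 0 * p.2 0 0 + p.1 0 1 * p.2 0 1)) /
  (1 - (p.1 0 0 ^+ 2 + p.1 0 1 ^+ 2)).
Proof.
case: p => x y; rewrite /funk !enorm_sqr edotE /funk_disc /=.
by congr ((Num.sqrt _ + _) / _); ring.
Qed.

Lemma slitP p : S p <->
  p.1 0 0 ^+ 2 + p.1 0 1 ^+ 2 < 1 /\ 0 < p.2 0 0 ^+ 2 + p.2 0 1 ^+ 2.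
Proof.
rewrite /slit_tangent_bundle /= unit_ballE.
suff -> : (p.2 != 0) = (0 < p.2 0 0 ^+ 2 + p.2 0 1 ^+ 2) by [].
rewrite lt0r addr_ge0 ?sqr_ge0 // andbT paddr_eq0 ?sqr_ge0 // !sqrf_eq0.
congr (~~ _); apply/eqP/andP => [-> | [/eqP y0 /eqP y1]]; first by rewrite !mxE.
by apply/rowP => i; rewrite mxE; case: (ord2_cases i) => ->.
Qed.

Lemma funk_disc_gt0 p : S p -> 0 < funk_disc p.
Proof.
move=> /slitP[x1 y0]; rewrite /funk_disc.
set a := p.1 0 0 in x1 *; set b := p.1 0 1 in x1 *.
set c := p.2 0 0 in y0 *; set d := p.2 0 1 in y0 *.
have -> : c ^+ 2 + d ^+ 2 - (a * d - b * c) ^+ 2 =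
  (1 - (a ^+ 2 + b ^+ 2)) * (c ^+ 2 + d ^+ 2) + (a * c + b * d) ^+ 2 by ring.
by apply: ltr_pwDl; rewrite ?mulr_gt0 ?subr_gt0 ?sqr_ge0.
Qed.

(** The radicand exceeds $\langle x,y\rangle^2$ by $(1-|x|^2)|y|^2>0$, so the root dominates
    $|\langle x,y\rangle|$. *)
Lemma funk_gt0 p : S p -> 0 < F p.
Proof.
move=> Sp; have d0 := funk_disc_gt0 Sp; move/slitP: Sp => [x1 y0].
rewrite funkE divr_gt0 ?subr_gt0 //.
set z := (X in _ + X); rewrite -[z]opprK subr_gt0.
apply: le_lt_trans (ler_norm _) _; rewrite normrN -sqrtr_sqr.
rewrite ltr_sqrt // /funk_disc /z -subr_gt0.
move: x1 y0; set a := p.1 0 0; set b := p.1 0 1; set c := p.2 0 0; set d := p.2 0 1.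
move=> x1 y0.
have -> : c ^+ 2 + d ^+ 2 - (a * d - b * c) ^+ 2 - (a * c + b * d) ^+ 2 =
  (1 - (a ^+ 2 + b ^+ 2)) * (c ^+ 2 + d ^+ 2) by ring.
by rewrite mulr_gt0 ?subr_gt0.
Qed.

(* The coordinates of the point [x + y / F(x, y)], where the ray from [x] in
   direction [y] leaves the disk. *)
Definition exit1 p : R := p.1 0 0 + p.2 0 0 * (F p)^-1.
Definition exit2 p : R := p.1 0 1 + p.2 0 1 * (F p)^-1.

Local Notation c := exit1.
Local Notation s := exit2.

Definition exit_gap p : R := 1 - (p.1 0 0 * c p + p.1 0 1 * s p).
Local Notation D := exit_gap.

(** Both sides equal $(1-|x|^2)F-\langle x,y\rangle$. This removes the square root: from here on
    everything is rational in $x$, $F$ and the exit point. *)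
Lemma funk_sqrt_disc p : S p -> Num.sqrt (funk_disc p) = F p * D p.
Proof.
move=> Sp; have F0 := funk_gt0 Sp; move/slitP: (Sp) => [x1 _].
have -> : F p * D p = (1 - (p.1 0 0 ^+ 2 + p.1 0 1 ^+ 2)) * F p -
   (p.1 0 0 * p.2 0 0 + p.1 0 1 * p.2 0 1).
  by rewrite /exit_gap /exit1 /exit2; field; rewrite gt_eqF.
rewrite funkE mulrC divfK ?addrK //.
by rewrite gt_eqF // subr_gt0.
Qed.

Lemma exit_gap_gt0 p : S p -> 0 < D p.
Proof.
move=> Sp; rewrite -(pmulr_rgt0 _ (funk_gt0 Sp)) -funk_sqrt_disc //.
by rewrite sqrtr_gt0 funk_disc_gt0.
Qed.

(** Squaring $\sqrt{\mathrm{disc}}=FD$ gives $(1-|x|^2)F^2(|u|^2-1)=0$, whose first two factors are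
    nonzero. *)
Lemma exit_circle p : S p -> c p ^+ 2 + s p ^+ 2 = 1.
Proof.
move=> Sp; have F0 := funk_gt0 Sp; have F0' : F p != 0 by rewrite gt_eqF.
have := funk_sqrt_disc Sp; move/(congr1 (fun z => z ^+ 2)).
rewrite sqr_sqrtr ?ltW ?funk_disc_gt0 // /exit_gap /exit1 /exit2 /funk_disc => h.
move/slitP: Sp => [x1 _].
apply/eqP; rewrite -subr_eq0.
have : (1 - (p.1 0 0 ^+ 2 + p.1 0 1 ^+ 2)) * F p ^+ 2 *
  ((p.1 0 0 + p.2 0 0 * (F p)^-1) ^+ 2 + (p.1 0 1 + p.2 0 1 * (F p)^-1) ^+ 2 - 1)
  = 0.
  move/eqP: h; rewrite -subr_eq0 => /eqP h.
  by rewrite -h; field.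
move/eqP; rewrite !mulf_eq0 (negPf F0') /= !orbF => /orP[|//].
by rewrite gt_eqF // subr_gt0.
Qed.

Lemma fibre1E p : S p -> p.2 0 0 = F p * (c p - p.1 0 0).
Proof. by move=> /funk_gt0 F0; rewrite /exit1; field; rewrite gt_eqF. Qed.

Lemma fibre2E p : S p -> p.2 0 1 = F p * (s p - p.1 0 1).
Proof. by move=> /funk_gt0 F0; rewrite /exit2; field; rewrite gt_eqF. Qed.

Lemma nbhs_slit p : S p -> \forall q \near p, S q.
Proof.
have cf : continuous (fun q : TE => q.1 0 0 ^+ 2 + q.1 0 1 ^+ 2).
  move=> q; apply: (@cvgD _ R^o); apply: cvgM;
    apply: (@continuous_comp _ _ _ fst (fun x : E => x 0 _));
    by [exact: cvg_fst | exact: coord_continuous].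
have cg : continuous (fun q : TE => q.2 0 0 ^+ 2 + q.2 0 1 ^+ 2).
  move=> q; apply: (@cvgD _ R^o); apply: cvgM;
    apply: (@continuous_comp _ _ _ snd (fun x : E => x 0 _));
    by [exact: cvg_snd | exact: coord_continuous].
move=> /slitP[x1 y0].
near=> q; apply/slitP; split; near: q.
- exact: (cvgr_lt _ (cf p)).
- exact: (cvgr_gt _ (cg p)).
Unshelve. all: by end_near. Qed.

(** The value is the one given by implicit differentiation of $|x+y/F|^2=1$, since $\langle
    u,y/F\rangle=D$. The proof differentiates the explicit formula and compares. *)
Lemma is_derive_funk p v : S p ->
  is_derive p v F ((c p * (F p * v.1 0 0 + v.2 0 0) +
                    s p * (F p * v.1 0 1 + v.2 0 1)) / D p).
Proof.
move=> Sp; have F0 := funk_gt0 Sp; have D0 := exit_gap_gt0 Sp.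
have d0 := funk_disc_gt0 Sp.
have hS := funk_sqrt_disc Sp.
have hD : D p = 1 - (p.1 0 0 * c p + p.1 0 1 * s p) by [].
move/slitP: (Sp) => [x1 _].
have B0 : 1 - (p.1 0 0 ^+ 2 + p.1 0 1 ^+ 2) != 0 by rewrite gt_eqF // subr_gt0.
have hd : is_derive p v funk_disc (2 * p.2 0 0 * v.2 0 0 + 2 * p.2 0 1 * v.2 0 1 -
   2 * (p.1 0 0 * p.2 0 1 - p.1 0 1 * p.2 0 0) *
   (p.1 0 0 * v.2 0 1 + v.1 0 0 * p.2 0 1 - p.1 0 1 * v.2 0 0 - v.1 0 1 * p.2 0 0)).
  by rewrite /funk_disc; derive; ring.
have hs := is_derive_sqrt_fun d0 hd.
rewrite (funext funkE); derive; first exact: B0.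
(* With $y=F(u-x)$ substituted, the only remaining relation between the variables is $|u|^2=1$. *)
rewrite hS (fibre1E Sp) (fibre2E Sp) hD.
have := exit_circle Sp; set a := c p; set b := s p; move=> hab.
have {}hab : b ^+ 2 = 1 - a ^+ 2 by rewrite -hab; ring.
by field: hab; rewrite -hD B0 !gt_eqF.
Qed.

(** The value $dt(v)$ of the differential of the exit angle $t$, where $u=(\cos t,\sin t)$. *)
Definition exit_rate p v : R :=
  ((p.1 0 1 - s p) * (F p * v.1 0 0 + v.2 0 0) +
   (c p - p.1 0 0) * (F p * v.1 0 1 + v.2 0 1)) / (F p * D p).

Lemma exit2_sqr p : S p -> s p ^+ 2 = 1 - c p ^+ 2.
Proof. by move=> /exit_circle <-; ring. Qed.

Lemma funk_neq0 p : S p -> F p != 0.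
Proof. by move=> /funk_gt0/gt_eqF ->. Qed.

Lemma exit_gap_neq0 p : S p -> 1 - (p.1 0 0 * c p + p.1 0 1 * s p) != 0.
Proof. by move=> /exit_gap_gt0/gt_eqF/negbT. Qed.

Lemma is_derive_exit1 p v : S p -> is_derive p v c (- s p * exit_rate p v).
Proof.
move=> Sp; have Fd := is_derive_funk v Sp; have D0 := exit_gap_neq0 Sp.
have F0 := funk_neq0 Sp; have us := exit2_sqr Sp.
rewrite /exit1; derive; first exact: F0.
rewrite (fibre1E Sp) /exit_rate /exit_gap.
by field: us; rewrite D0 F0.
Qed.

Lemma is_derive_exit2 p v : S p -> is_derive p v s (c p * exit_rate p v).
Proof.
move=> Sp; have Fd := is_derive_funk v Sp; have D0 := exit_gap_neq0 Sp.
have F0 := funk_neq0 Sp; have us := exit2_sqr Sp.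
rewrite /exit2; derive; first exact: F0.
rewrite (fibre2E Sp) /exit_rate /exit_gap.
by field: us; rewrite D0 F0.
Qed.

Lemma is_derive_exit_gap p v : S p -> is_derive p v D
  (- (v.1 0 0 * c p + v.1 0 1 * s p) +
   (p.1 0 0 * s p - p.1 0 1 * c p) * exit_rate p v).
Proof.
move=> Sp; have cd := is_derive_exit1 v Sp; have sd := is_derive_exit2 v Sp.
by rewrite /exit_gap; derive; ring.
Qed.

(** * Metric and spray of the Funk surface *)

(** The closed forms below hold only on the slit bundle; as it is open, they may still be
    differentiated there. *)
Lemma is_derive_slit (W : normedModType R) (f g : TE -> W) p v df :
  S p -> (forall q, S q -> f q = g q) -> is_derive p v f df -> is_derive p v g df.
Proof.
move=> Sp fg; apply: near_eq_is_derive.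
by near do apply: fg; apply: nbhs_slit.
Unshelve. all: by end_near. Qed.

Definition exit_pt (i : 'I_2) p : R := if i == 0 then c p else s p.
Definition exit_tan (i : 'I_2) p : R := if i == 0 then - s p else c p.
(* [y / F] rotated by a quarter turn. *)
Definition fibre_normal (i : 'I_2) p : R :=
  if i == 0 then p.1 0 1 - s p else c p - p.1 0 0.

Lemma is_derive_exit_pt i p v : S p ->
  is_derive p v (exit_pt i) (exit_tan i p * exit_rate p v).
Proof.
by case: (ord2_cases i) => -> /=; [exact: is_derive_exit1 | exact: is_derive_exit2].
Qed.

Definition dfibre_normal (i : 'I_2) p v : R :=
  (if i == 0 then v.1 0 1 else - v.1 0 0) - exit_pt i p * exit_rate p v.

Lemma is_derive_fibre_normal i p v : S p ->
  is_derive p v (fibre_normal i) (dfibre_normal i p v).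
Proof.
move=> Sp; have cd := is_derive_exit1 v Sp; have sd := is_derive_exit2 v Sp.
by case: (ord2_cases i) => ->; rewrite /fibre_normal /dfibre_normal /exit_pt /=;
  derive; ring.
Qed.

Lemma ddy_funk_sqr j p : S p ->
  ddy j (fun q => F q ^+ 2) p = 2 * F p * (exit_pt j p * (D p)^-1).
Proof.
move=> Sp; have Fd := is_derive_funk (0, delta_mx 0 j) Sp.
apply: derive_val.
derive; rewrite /exit_pt.
have D0 := gt_eqF (exit_gap_gt0 Sp).
by case: (ord2_cases j) => ->; rewrite !mxE /=; field; rewrite D0.
Qed.

(** From $F_{y^i}=u_i/D$, the two terms are $F_{y^i}F_{y^j}$ and $F\,F_{y^iy^j}$, the latter being
    of rank one along the normal to $y$. *)
Lemma metric_coefE i j p : S p -> metric_coef F i j p =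
  exit_pt i p * exit_pt j p * ((D p)^-1) ^+ 2 +
  fibre_normal i p * fibre_normal j p * ((D p)^-1 * ((D p)^-1) ^+ 2).
Proof.
move=> Sp; set v : TE := (0, delta_mx 0 i).
have Fd := is_derive_funk v Sp; have ud := is_derive_exit_pt j v Sp.
have Dd := is_derive_exit_gap v Sp.
have D0 := exit_gap_neq0 Sp; have F0 := funk_neq0 Sp; have us := exit2_sqr Sp.
rewrite /metric_coef /ddy.
have -> : 'D_v (ddy j (fun q => F q ^+ 2)) p =
   2 * (fibre_normal i p * fibre_normal j p * ((D p)^-1 * ((D p)^-1) ^+ 2) +
  exit_pt i p * exit_pt j p * ((D p)^-1) ^+ 2).
  apply: derive_val.
  apply: (@is_derive_slit _ (fun q => 2 * F q * (exit_pt j q * (D q)^-1))) => //.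
    by move=> q /ddy_funk_sqr ->.
  derive; first exact: D0.
  rewrite /v /exit_rate /exit_gap /fibre_normal /exit_pt /exit_tan.
  by case: (ord2_cases i) => ->; case: (ord2_cases j) => ->; rewrite !mxE /=;
    field: us; rewrite D0 F0.
by rewrite addrC; field; rewrite gt_eqF // exit_gap_gt0.
Qed.

Definition dmetric (i j : 'I_2) p v : R :=
  (exit_tan i p * exit_pt j p + exit_pt i p * exit_tan j p) * exit_rate p v / D p ^+ 2
  + (dfibre_normal i p v * fibre_normal j p +
     fibre_normal i p * dfibre_normal j p v) / D p ^+ 3
  - (2 * exit_pt i p * exit_pt j p / D p ^+ 3 +
     3 * fibre_normal i p * fibre_normal j p / D p ^+ 4) *
    (- (v.1 0 0 * c p + v.1 0 1 * s p) +
     (p.1 0 0 * s p - p.1 0 1 * c p) * exit_rate p v).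

Lemma is_derive_metric_coef i j p v : S p ->
  is_derive p v (metric_coef F i j) (dmetric i j p v).
Proof.
move=> Sp.
have Fd := is_derive_funk v Sp; have uid := is_derive_exit_pt i v Sp.
have ujd := is_derive_exit_pt j v Sp.
have nid := is_derive_fibre_normal i v Sp; have njd := is_derive_fibre_normal j v Sp.
have Dd := is_derive_exit_gap v Sp.
have D0 : D p != 0 := exit_gap_neq0 Sp.
apply: (@is_derive_slit _ (fun q =>
    exit_pt i q * exit_pt j q * ((D q)^-1) ^+ 2 +
    fibre_normal i q * fibre_normal j q * ((D q)^-1 * ((D q)^-1) ^+ 2))) => //.
  by move=> q /metric_coefE ->.
derive; [exact: D0.. | ].
rewrite /dmetric; field.
exact: D0.
Qed.

Lemma metric_unit p : S p -> metric F p \in unitmx.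
Proof.
move=> Sp; have us := exit2_sqr Sp; have D0 := exit_gap_neq0 Sp.
(* The inverse is the adjugate over the determinant. Since $u_0n_1-u_1n_0=D$ for the fibre normal
   $n$, the determinant is $D^2/D^5=D^{-3}$; the index [1 - i] is the other element of ['I_2]. *)
pose g i j := metric_coef F i j p.
pose B : 'M[R]_2 := \matrix_(i, j) (D p ^+ 3 *
  (if i == j then g (1 - i) (1 - i) else - g i j)).
suff gB : metric F p *m B = 1%:M by case: (mulmx1_unit gB).
apply/matrixP => i j; rewrite !mxE sum_ord2 !mxE /g.
case: (ord2_cases i) => ->; case: (ord2_cases j) => -> /=; rewrite !metric_coefE //.
all: rewrite /exit_gap /fibre_normal /exit_pt /=.
all: by field: us.
Qed.

(** This is $G^i=\frac12Fy^i$ with the index lowered, the form in which projective flatness can be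
    checked without inverting the metric. *)
Lemma spray_rhsE l p : S p ->
  \sum_(j < 2) \sum_(k < 2)
    (2 * ddx k (metric_coef F j l) p - ddx l (metric_coef F j k) p) *
    p.2 0 j * p.2 0 k =
  2 * F p * \sum_(m < 2) metric_coef F l m p * p.2 0 m.
Proof.
move=> Sp; have us := exit2_sqr Sp; have D0 : D p != 0 := exit_gap_neq0 Sp.
have F0 := funk_neq0 Sp.
have ddxE (i j k : 'I_2) : ddx i (metric_coef F j k) p = dmetric j k p (delta_mx 0 i, 0).
  by apply: derive_val; exact: is_derive_metric_coef.
transitivity (\sum_(j < 2) \sum_(k < 2)
    (2 * dmetric j l p (delta_mx 0 k, 0) - dmetric j k p (delta_mx 0 l, 0)) *
    p.2 0 j * p.2 0 k).
  by apply: eq_bigr => j _; apply: eq_bigr => k _; congr ((2 * _ - _) * _ * _);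
    exact: ddxE.
rewrite !sum_ord2 !metric_coefE //.
(* The vector $y/F$ is recovered from its quarter-turn rotation, so that $x$ and $y$ can be
   eliminated in favour of $u$ and the fibre normal. *)
have -> : p.2 0 0 = F p * fibre_normal 1 p by rewrite (fibre1E Sp).
have -> : p.2 0 1 = - F p * fibre_normal 0 p.
  by rewrite (fibre2E Sp) /fibre_normal /=; ring.
have rate (k : 'I_2) : exit_rate p (delta_mx 0 k, 0) = fibre_normal k p / D p.
  rewrite /exit_rate /fibre_normal.
  by case: (ord2_cases k) => ->; rewrite !mxE /=; field; rewrite D0 F0.
have Dt : p.1 0 0 * s p - p.1 0 1 * c p =
    exit_tan 0 p * fibre_normal 1 p - exit_tan 1 p * fibre_normal 0 p.
  by rewrite /exit_tan /fibre_normal /=; ring.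
have DE : D p = exit_pt 0 p * fibre_normal 1 p - exit_pt 1 p * fibre_normal 0 p.
  by rewrite /exit_gap /exit_pt /fibre_normal /=; ring: us.
have c_pt : c p = exit_pt 0 p by [].
have s_pt : s p = exit_pt 1 p by [].
(* In terms of [exit_pt], [exit_tan] and [fibre_normal] the variables satisfy no
   further relation, so that [field] decides the identity. *)
rewrite /dmetric /dfibre_normal !rate Dt c_pt s_pt.
rewrite DE in D0 *.
set u0 := exit_pt 0 p in D0 *; set u1 := exit_pt 1 p in D0 *.
set n0 := fibre_normal 0 p in D0 *; set n1 := fibre_normal 1 p in D0 *.
by case: (ord2_cases l) => ->; rewrite -/u0 -/u1 -/n0 -/n1 !mxE /=; field.
Qed.

Lemma spray_coefE i p : S p -> spray_coef F i p = 2^-1 * (F p * p.2 0 i).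
Proof.
move=> Sp; rewrite /spray_coef.
have -> : \sum_(l < 2) \sum_(j < 2) \sum_(k < 2) invmx (metric F p) i l *
    (2 * ddx k (metric_coef F j l) p - ddx l (metric_coef F j k) p) *
    p.2 0 j * p.2 0 k =
  2 * F p * (invmx (metric F p) *m (metric F p *m p.2^T)) i 0.
  rewrite mxE big_distrr /=; apply: eq_bigr => l _.
  rewrite mxE mulrCA; under [in RHS]eq_bigr do rewrite !mxE.
  rewrite -(spray_rhsE l Sp) big_distrr; apply: eq_bigr => j _.
  by rewrite big_distrr; apply: eq_bigr => k _; rewrite /= !mulrA.
by rewrite mulKmx ?metric_unit // mxE; field.
Qed.

(** * Horizontal lifts, curvature and Berwald derivative *)

Lemma connection_coefE i j p : S p -> connection_coef F i j p =
  2^-1 * (exit_pt j p / D p * p.2 0 i + F p * (i == j)%:R).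
Proof.
move=> Sp; have Fd := is_derive_funk (0, delta_mx 0 j) Sp.
have D0 : D p != 0 := exit_gap_neq0 Sp.
apply: derive_val.
apply: (@is_derive_slit _ (fun q => 2^-1 * (F q * q.2 0 i))) => //.
  by move=> q /(spray_coefE i) ->.
derive; rewrite /exit_pt.
by case: (ord2_cases i) => ->; case: (ord2_cases j) => ->; rewrite !mxE /=;
  field; rewrite D0.
Qed.

Definition row2 (a b : R) : E := \row_i if i == 0 then a else b.

Lemma row2P (x : E) a b : x 0 0 = a -> x 0 1 = b -> x = row2 a b.
Proof.
by move=> xa xb; apply/rowP => i; rewrite mxE; case: (ord2_cases i) => ->.
Qed.

Lemma is_derive_row2 (V : normedModType R) (f g : V -> R) (p v : V) df dg :
  is_derive p v f df -> is_derive p v g dg ->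
  is_derive p v (fun q => row2 (f q) (g q)) (row2 df dg).
Proof.
move=> fd gd.
by apply: (is_derive_row (f := fun q i => if i == 0 then f q else g q)
  (df := fun i => if i == 0 then df else dg)) => i; case: ifP.
Qed.

(* Angular velocity of the exit point along the horizontal lift of [X]. *)
Definition hor_rate X p : R :=
  (X 0 0 * (p.1 0 1 - s p) + X 0 1 * (c p - p.1 0 0)) * (2 * D p)^-1.

(** As $y=F(u-x)$ and $F$ stays constant along the lift, the fibre component is $F(\dot u-X)$, with
    $\dot u$ the velocity of the exit point. *)
Definition hor_field X p : TE :=
  (X, row2 (F p * (- s p * hor_rate X p - X 0 0))
           (F p * (c p * hor_rate X p - X 0 1))).

Lemma horizontal_liftE X p : S p ->
  horizontal_lift F (fun=> X) p = hor_field X p.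
Proof.
move=> Sp; have us := exit2_sqr Sp; have D0 := exit_gap_neq0 Sp.
rewrite /horizontal_lift /hor_field; congr pair; apply: row2P.
  rewrite !mxE sum_ord2 !connection_coefE // (fibre1E Sp).
  by rewrite /hor_rate /exit_gap /exit_pt /=; field: us.
rewrite !mxE sum_ord2 !connection_coefE // (fibre2E Sp).
by rewrite /hor_rate /exit_gap /exit_pt /=; field: us.
Qed.

(* The vertical field [phi(x, t) d/dt], in the coordinates [(x, t, F)] of the
   slit tangent bundle in which [exit_pt = (cos t, sin t)]. *)
Definition rot_field (phi : R) p : TE :=
  (0, row2 (F p * (- s p * phi)) (F p * (c p * phi))).

Lemma is_derive_hor_exit X p : S p ->
 [/\ is_derive p (hor_field X p) F 0,
     is_derive p (hor_field X p) c (- s p * hor_rate X p) &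
     is_derive p (hor_field X p) s (c p * hor_rate X p)].
Proof.
move=> Sp; have us := exit2_sqr Sp; have D0 := exit_gap_neq0 Sp.
have F0 := funk_neq0 Sp.
have rate : exit_rate p (hor_field X p) = hor_rate X p.
  rewrite /exit_rate /hor_field /= !mxE /=.
  by rewrite /hor_rate /exit_gap; field: us; rewrite D0 F0.
split.
- apply: is_derive_eq (is_derive_funk _ Sp) _; rewrite /hor_field /= !mxE /=.
  by rewrite /hor_rate /exit_gap; field: us.
- by rewrite -rate; apply: is_derive_exit1.
- by rewrite -rate; apply: is_derive_exit2.
Qed.

Lemma is_derive_hor_exit_gap X p : S p ->
  is_derive p (hor_field X p) D (- (X 0 0 * c p + X 0 1 * s p) +
    (p.1 0 0 * s p - p.1 0 1 * c p) * hor_rate X p).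
Proof.
move=> Sp; have [Fd cd sd] := is_derive_hor_exit X Sp.
by rewrite /exit_gap; derive; ring.
Qed.

Lemma is_derive_rot_exit a p : S p ->
 [/\ is_derive p (rot_field a p) F 0,
     is_derive p (rot_field a p) c (- s p * a) &
     is_derive p (rot_field a p) s (c p * a)].
Proof.
move=> Sp; have us := exit2_sqr Sp; have D0 := exit_gap_neq0 Sp.
have F0 := funk_neq0 Sp.
have rate : exit_rate p (rot_field a p) = a.
  rewrite /exit_rate /rot_field /= !mxE /=.
  by rewrite /exit_gap; field: us; rewrite D0 F0.
split.
- apply: is_derive_eq (is_derive_funk _ Sp) _; rewrite /rot_field /= !mxE /=.
  by rewrite /exit_gap; field: us.
- by rewrite -{2}rate; apply: is_derive_exit1.
- by rewrite -{2}rate; apply: is_derive_exit2.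
Qed.

(** A bracket depends only on germs, and the slit bundle is open, so fields may be replaced by their
    closed forms. *)
Lemma eq_lie_bracket (A A' B B' : TE -> TE) p : S p ->
  (forall q, S q -> A q = A' q) -> (forall q, S q -> B q = B' q) ->
  lie_bracket A B p = lie_bracket A' B' p.
Proof.
move=> Sp AA' BB'; rewrite /lie_bracket (AA' _ Sp) (BB' _ Sp).
apply: (f_equal2 (fun u w => u - w)); apply: near_eq_derive.
  by near do apply: BB'; apply: nbhs_slit.
by near do apply: AA'; apply: nbhs_slit.
Unshelve. all: by end_near. Qed.

(** This is $[X+a_X\partial_t,\varphi\partial_t]=(X^h\varphi-\varphi\,\partial_ta_X)\partial_t$; the
    factor of [phi p] is $\partial_ta_X$, as $\partial_tD=x_1\sin t-x_2\cos t$. *)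
Lemma berwald_rot X (xi : TE -> TE) (phi : TE -> R) p dphi : S p ->
  (forall q, S q -> xi q = rot_field (phi q) q) ->
  is_derive p (hor_field X p) phi dphi ->
  berwald F (fun=> X) xi p = rot_field (dphi - phi p *
   (- (X 0 0 * c p + X 0 1 * s p) / (2 * D p) -
    hor_rate X p * (p.1 0 0 * s p - p.1 0 1 * c p) / D p)) p.
Proof.
move=> Sp xiE phid; have D0 : D p != 0 := exit_gap_neq0 Sp.
rewrite /berwald (eq_lie_bracket Sp (@horizontal_liftE X) xiE).
have [Fd cd sd] := is_derive_hor_exit X Sp.
have [Fr cr sr] := is_derive_rot_exit (phi p) Sp.
rewrite /lie_bracket.
(* The products of [hor_rate X p] and [phi p] come from the rotation of the frame; they recur in
   [E2] and cancel in the bracket. *)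
have E1 : is_derive p (hor_field X p) (fun q => rot_field (phi q) q)
   (0, row2 (F p * (- (c p * hor_rate X p) * phi p - s p * dphi))
       (F p * (- (s p * hor_rate X p) * phi p + c p * dphi))).
  apply: is_derive_pair.
  by apply: is_derive_row2; derive; ring.
have ar : is_derive p (rot_field (phi p) p) (hor_rate X)
  (phi p * (- (X 0 0 * c p + X 0 1 * s p) / (2 * D p) -
    hor_rate X p * (p.1 0 0 * s p - p.1 0 1 * c p) / D p)).
  have Dr : is_derive p (rot_field (phi p) p) D (phi p * (p.1 0 0 * s p - p.1 0 1 * c p)).
    by rewrite /exit_gap; derive; rewrite !mxE; ring.
  rewrite /hor_rate; derive; first by rewrite mulf_neq0 // pnatr_eq0.
  by rewrite !mxE; field; rewrite D0.
set da := (X in is_derive _ _ (hor_rate _) X) in ar.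
have E2 : is_derive p (rot_field (phi p) p) (hor_field X)
   (0, row2 (F p * (- (c p * phi p) * hor_rate X p - s p * da))
       (F p * (- (s p * phi p) * hor_rate X p + c p * da))).
  apply: is_derive_pair.
  by apply: is_derive_row2; derive; ring.
rewrite (derive_val (is_derive := E1)) (derive_val (is_derive := E2)).
congr pair; first by rewrite subr0.
by apply: row2P; rewrite !mxE /= ?mxE /=; rewrite -/da; ring.
Qed.

Lemma curvatureE p : S p ->
  curvature_field F (fun=> row2 1 0) (fun=> row2 0 1) p =
  rot_field (- (4 * D p)^-1) p.
Proof.
move=> Sp; have D0 : D p != 0 := exit_gap_neq0 Sp.
have us := exit2_sqr Sp.
rewrite /curvature_field (eq_lie_bracket Sp (@horizontal_liftE _) (@horizontal_liftE _)).
(* [da X Y] is $X^ha_Y$, so the curvature is $(X^ha_Y-Y^ha_X)\partial_t$. *)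
pose da (X Y : E) : R := (Y 0 0 * (X 0 1 - c p * hor_rate X p) -
    Y 0 1 * (X 0 0 + s p * hor_rate X p)) / (2 * D p) -
  hor_rate Y p * (- (X 0 0 * c p + X 0 1 * s p) +
    (p.1 0 0 * s p - p.1 0 1 * c p) * hor_rate X p) / D p.
have E X Y : is_derive p (hor_field X p) (hor_field Y)
   (0, row2 (F p * (- (c p * hor_rate X p) * hor_rate Y p - s p * da X Y))
       (F p * (- (s p * hor_rate X p) * hor_rate Y p + c p * da X Y))).
  have [Fd cd sd] := is_derive_hor_exit X Sp.
  have Dd := is_derive_hor_exit_gap X Sp.
  have ad : is_derive p (hor_field X p) (hor_rate Y) (da X Y).
    rewrite [hor_rate Y]/hor_rate; derive; first by rewrite mulf_neq0 // pnatr_eq0.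
    by rewrite /da /hor_rate /=; field; rewrite D0.
  by apply: is_derive_pair; apply: is_derive_row2; derive; ring.
rewrite /lie_bracket (derive_val (is_derive := E _ _)) (derive_val (is_derive := E _ _)).
rewrite /vertical_proj /=; congr pair.
(* Constant fields commute on the base, so the bracket is already vertical. *)
have -> : connection_map F p (0 - 0) = 0.
  by apply/rowP => k; rewrite subr0 !mxE big1 // => i _; rewrite mxE mul0r.
rewrite addr0; apply: row2P; rewrite !mxE /= /da /hor_rate !mxE /= /exit_gap.
  by field: us.
by field: us.
Qed.

(** * Vector fields on the indicatrix over the origin *)

Lemma smooth_on_cst (V W : normedModType R) (U : set V) (a : W) :
  smooth_on U (fun=> a).
Proof.
move=> k; elim: k a => [|k IHk] a /=; first by move=> x _; exact: cst_continuous.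
split=> [x _|v]; first exact: differentiable_cst.
rewrite (_ : 'D_v (fun=> a) = fun=> 0); first exact: IHk.
by apply/funext => x; exact: derive_cst.
Qed.

(** The [hor_rate] terms of $X^h\varphi$ and $\varphi\,\partial_ta_X$ cancel. The formula is kept
    over the whole disk because it is differentiated once more; the second derivative is needed only
    over $0$. *)
Lemma berwald_curvatureE X p : S p ->
  berwald F (fun=> X) (curvature_field F (fun=> row2 1 0) (fun=> row2 0 1)) p =
  rot_field (- (3 / 8) * ((X 0 0 * c p + X 0 1 * s p) * (D p)^-1 ^+ 2)) p.
Proof.
move=> Sp; have D0 : D p != 0 := exit_gap_neq0 Sp.
have [Fd cd sd] := is_derive_hor_exit X Sp.
have Dd := is_derive_hor_exit_gap X Sp.
have phid : is_derive p (hor_field X p) (fun q => - (4 * D q)^-1)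
   ((- (X 0 0 * c p + X 0 1 * s p) +
    (p.1 0 0 * s p - p.1 0 1 * c p) * hor_rate X p) / (4 * D p ^+ 2)).
  derive; first by rewrite mulf_neq0 // pnatr_eq0.
  by field; rewrite D0.
rewrite (berwald_rot Sp curvatureE phid).
by congr rot_field; field; rewrite D0.
Qed.

Lemma berwald2_curvatureE X Y p : S p -> p.1 = 0 ->
  berwald F (fun=> X) (berwald F (fun=> Y)
    (curvature_field F (fun=> row2 1 0) (fun=> row2 0 1))) p =
  rot_field (- (3 / 8) *
    (2^-1 * (Y 0 1 * c p - Y 0 0 * s p) * (X 0 1 * c p - X 0 0 * s p) +
     5 / 2 * (Y 0 0 * c p + Y 0 1 * s p) * (X 0 0 * c p + X 0 1 * s p))) p.
Proof.
move=> Sp p0; have D0 : D p != 0 := exit_gap_neq0 Sp.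
have [Fd cd sd] := is_derive_hor_exit X Sp.
have Dd : is_derive p (hor_field X p) D (- (X 0 0 * c p + X 0 1 * s p)).
  by rewrite /exit_gap; derive; rewrite p0 !mxE; ring.
have phid : is_derive p (hor_field X p) (fun q => - (3 / 8) *
    ((Y 0 0 * c q + Y 0 1 * s q) * (D q)^-1 ^+ 2))
   (- (3 / 8) * ((Y 0 1 * c p - Y 0 0 * s p) * hor_rate X p +
     2 * (Y 0 0 * c p + Y 0 1 * s p) * (X 0 0 * c p + X 0 1 * s p))).
  derive; first exact: D0.
  by rewrite /exit_gap p0 !mxE; field.
rewrite (berwald_rot Sp (@berwald_curvatureE _) phid).
by congr rot_field; rewrite /hor_rate /exit_gap p0 !mxE; field.
Qed.

Lemma circle_slit r t : 0 < r -> S (0, r *: circle_point t).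
Proof.
move=> r0; apply/slitP; rewrite /= !mxE expr0n addr0 ltr01 /=; split=> //.
by rewrite !exprMn -mulrDr cos2Dsin2 mulr1 exprn_gt0.
Qed.

Lemma funk_circle r t : 0 < r -> F (0, r *: circle_point t) = r.
Proof.
move=> r0; rewrite funkE /funk_disc /= !mxE /= !mul0r subrr expr0n subr0 !addr0
  subr0 divr1.
by rewrite !exprMn -mulrDr cos2Dsin2 mulr1 sqrtr_sqr ger0_norm // ltW.
Qed.

Lemma exit1_circle r t : 0 < r -> c (0, r *: circle_point t) = cos t.
Proof.
by move=> r0; rewrite /exit1 funk_circle // !mxE /= add0r mulrAC divff ?mul1r // gt_eqF.
Qed.

Lemma exit2_circle r t : 0 < r -> s (0, r *: circle_point t) = sin t.
Proof.
by move=> r0; rewrite /exit2 funk_circle // !mxE /= add0r mulrAC divff ?mul1r // gt_eqF.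
Qed.

Lemma rot_field_circle a r t : 0 < r ->
  rot_field a (0, r *: circle_point t) = (0, (r * a) *: circle_tangent t).
Proof.
move=> r0; rewrite /rot_field funk_circle // exit1_circle // exit2_circle //.
by congr pair; apply/esym/row2P; rewrite !mxE /=; ring.
Qed.

(* Asking for 1-homogeneity on the whole fibre over 0, not only for the values
   on the unit circle, makes the bracket of two such fields computable. *)
Definition hol_circle (f : R -> R) : Prop :=
  exists2 xi, hol_star (@unit_ball R 2) F xi &
    forall r t, 0 < r ->
      xi (0, r *: circle_point t) = (0, (r * f t) *: circle_tangent t).

Lemma hol_circle0 : hol_circle (fun=> 0).
Proof.
exists (fun=> 0); first exact: hol_zero.
by move=> r t _; rewrite mulr0 scale0r.
Qed.

Lemma hol_circleD f g : hol_circle f -> hol_circle g ->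
  hol_circle (fun t => f t + g t).
Proof.
move=> [xi hxi xiE] [eta heta etaE]; exists (fun p => xi p + eta p).
  exact: hol_add.
move=> r t r0; rewrite xiE // etaE // mulrDr scalerDl.
by congr pair; exact: addr0.
Qed.

Lemma hol_circleZ a f : hol_circle f -> hol_circle (fun t => a * f t).
Proof.
move=> [xi hxi xiE]; exists (fun p => a *: xi p); first exact: hol_scale.
move=> r t r0; rewrite xiE //; congr pair; first exact: scaler0.
by rewrite /= scalerA mulrCA.
Qed.

(** * Brackets over the origin in polar coordinates *)

Lemma cos_sin_atan k :
  Num.sqrt (1 + k ^+ 2) != 0 /\ sin (atan k) = k / Num.sqrt (1 + k ^+ 2).
Proof.
have s0 : Num.sqrt (1 + k ^+ 2) != 0.
  by rewrite gt_eqF // sqrtr_gt0 ltr_pwDl ?sqr_ge0.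
have c0 : cos (atan k) != 0 by rewrite cos_atan invr_eq0.
by split=> //; rewrite -cos_atan -{2}[k]atanK /tan mulfVK.
Qed.

(** Polar coordinates on a tangent line of the unit circle: the segment of length $k$ is seen from
    the centre under the angle $\arctan k$. *)
Lemma circle_tangent_line k t :
  circle_point t + k *: circle_tangent t =
  Num.sqrt (1 + k ^+ 2) *: circle_point (t + atan k) :> E.
Proof.
have [s0 sk] := cos_sin_atan k.
by apply/rowP => i; rewrite !mxE cosD sinD sk cos_atan; case: ifP => _; field.
Qed.

(** The preceding identity turned by a right angle. *)
Lemma circle_tangent_rot k t :
  circle_tangent t - k *: circle_point t =
  Num.sqrt (1 + k ^+ 2) *: circle_tangent (t + atan k) :> E.
Proof.
have [s0 sk] := cos_sin_atan k.
by apply/rowP => i; rewrite !mxE cosD sinD sk cos_atan; case: ifP => _; field.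
Qed.

(** The direction is vertical, so the line stays in the fibre over $0$, the only place where [xi] is
    known. *)
Lemma is_derive_circle (xi : TE -> TE) (f : R -> R) (df : R) r t a : 0 < r ->
  (forall r t, 0 < r ->
      xi (0, r *: circle_point t) = (0, (r * f t) *: circle_tangent t)) ->
  is_derive t 1 f df ->
  is_derive ((0, r *: circle_point t) : TE) (0, (r * a) *: circle_tangent t) xi
    (0, (r * (a * df)) *: circle_tangent t - (r * (a * f t)) *: circle_point t).
Proof.
move=> r0 xiE fd; apply/is_derive_line.
set p : TE := (0, r *: _); set v : TE := (0, (r * a) *: _).
(* The point at parameter [h] has radius $r\sqrt{1+(ha)^2}$ and angle $t+\arctan(ha)$; by
   homogeneity of [xi] the square root is absorbed into the rotated tangent. *)
have gE (h : R) : xi (h *: v + p) =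
    (0, row2 (f (t + atan (h * a)) * (r * (- sin t - h * a * cos t)))
             (f (t + atan (h * a)) * (r * (cos t - h * a * sin t)))).
  pose q := Num.sqrt (1 + (h * a) ^+ 2).
  have q0 : 0 < q by rewrite sqrtr_gt0 ltr_pwDl ?sqr_ge0.
  have -> : h *: v + p = (0, (r * q) *: circle_point (t + atan (h * a))).
    rewrite -scalerA -circle_tangent_line; congr pair.
      by rewrite /= scaler0 addr0.
    by apply/rowP => i; rewrite /v /p /= !mxE; ring.
  rewrite xiE ?mulr_gt0 //; congr pair.
  rewrite (_ : r * q * _ = f (t + atan (h * a)) * r * q); last by ring.
  rewrite -scalerA -circle_tangent_rot.
  by apply: row2P; rewrite !mxE /=; ring.
have ad : is_derive (0 : R) 1 (fun h : R => t + atan (h * a)) a.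
  have had : is_derive (0 : R) 1 (fun h : R => h * a) a by derive; ring.
  have atd : is_derive (0 * a) 1 atan 1.
    by apply: is_derive_eq (is_derive1_atan _) _; rewrite mul0r expr0n addr0 invr1.
  have hd := @is_derive1_comp _ atan (fun h => h * a) _ _ _ atd had.
  by derive; ring.
have fcd : is_derive (0 : R) 1 (fun h : R => f (t + atan (h * a))) (a * df).
  have fd0 : is_derive (t + atan (0 * a)) 1 f df by rewrite mul0r atan0 addr0.
  by have := @is_derive1_comp _ f (fun h => t + atan (h * a)) _ _ _ fd0 ad; rewrite mulrC.
rewrite (funext gE).
have -> : (0, (r * (a * df)) *: circle_tangent t - (r * (a * f t)) *: circle_point t) =
    (0, row2 (r * (a * df) * - sin t - r * (a * f t) * cos t)
             (r * (a * df) * cos t - r * (a * f t) * sin t)) :> TE.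
  by congr pair; apply: row2P; rewrite !mxE.
apply: is_derive_pair.
by apply: is_derive_row2; derive; rewrite mul0r atan0 addr0; ring.
Qed.

(** The radial terms $-r f g$ of the two directional derivatives are symmetric in [f] and [g] and
    cancel, leaving the bracket of $f\partial_t$ and $g\partial_t$. *)
Lemma hol_circle_bracket f g df dg :
  (forall t : R, is_derive t 1 f (df t)) -> (forall t : R, is_derive t 1 g (dg t)) ->
  hol_circle f -> hol_circle g ->
  hol_circle (fun t => f t * dg t - g t * df t).
Proof.
move=> fd gd [xi hxi xiE] [eta heta etaE]; exists (lie_bracket xi eta).
  exact: hol_bracket.
move=> r t r0; rewrite /lie_bracket xiE // etaE //.
rewrite (derive_val (is_derive := is_derive_circle (f t) r0 etaE (gd t))).
rewrite (derive_val (is_derive := is_derive_circle (g t) r0 xiE (fd t))).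
congr pair; first exact: subr0.
by apply/rowP => i; rewrite !mxE; ring.
Qed.

Lemma hol_circle_rot (xi : TE -> TE) (phi : R -> R -> R) :
  hol_star (@unit_ball R 2) F xi ->
  (forall p, S p -> p.1 = 0 -> xi p = rot_field (phi (c p) (s p)) p) ->
  hol_circle (fun t => phi (cos t) (sin t)).
Proof.
move=> hxi xiE; exists xi => // r t r0.
rewrite xiE //; last exact: circle_slit.
by rewrite rot_field_circle // exit1_circle // exit2_circle.
Qed.

(** * Generation of the Witt algebra *)

Lemma exit_gap_base0 p : p.1 = 0 -> D p = 1.
Proof. by move=> p0; rewrite /exit_gap p0 !mxE !mul0r addr0 subr0. Qed.

Lemma hol_circle_low :
  [/\ hol_circle (fun=> 1), hol_circle (@cos R), hol_circle (@sin R),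
      hol_circle (fun t => cos (2 * t)) & hol_circle (fun t => sin (2 * t))].
Proof.
have hK : hol_star (@unit_ball R 2) F
    (curvature_field F (fun=> row2 1 0) (fun=> row2 0 1)).
  by apply: hol_curvature; exact: smooth_on_cst.
have hB X xi : hol_star (@unit_ball R 2) F xi ->
    hol_star (@unit_ball R 2) F (berwald F (fun=> X) xi).
  by apply: hol_berwald; exact: smooth_on_cst.
have h0 : hol_circle (fun=> - 4^-1).
  apply: (hol_circle_rot (phi := fun _ _ => _) hK) => p Sp p0.
  by rewrite curvatureE // exit_gap_base0 // mulr1.
have h1 X : hol_circle (fun t => - (3 / 8) * (X 0 0 * cos t + X 0 1 * sin t)).
  apply: (hol_circle_rot (phi := fun a b => - (3 / 8) * (X 0 0 * a + X 0 1 * b))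
    (hB X _ hK)) => p Sp p0.
  by rewrite berwald_curvatureE // exit_gap_base0 // invr1 expr1n mulr1.
have h2 X (Y : E) := hol_circle_rot (phi := fun a b => - (3 / 8) *
    (2^-1 * (Y 0 1 * a - Y 0 0 * b) * (X 0 1 * a - X 0 0 * b) +
     5 / 2 * (Y 0 0 * a + Y 0 1 * b) * (X 0 0 * a + X 0 1 * b)))
  (hB X _ (hB Y _ hK)) (@berwald2_curvatureE X Y).
have one : hol_circle (fun=> 1).
  rewrite (_ : (fun=> 1) = (fun=> - 4 * - 4^-1)); first exact: hol_circleZ.
  by apply/funext => t; field.
have dbl t : 2 * t = t + t by ring.
split=> //.
- rewrite (_ : @cos R = fun t => - (8 / 3) * (- (3 / 8) *
    (row2 1 0 0 0 * cos t + row2 1 0 0 1 * sin t))); first exact: hol_circleZ.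
  by apply/funext => t; rewrite !mxE /=; field.
- rewrite (_ : @sin R = fun t => - (8 / 3) * (- (3 / 8) *
    (row2 0 1 0 0 * cos t + row2 0 1 0 1 * sin t))); first exact: hol_circleZ.
  by apply/funext => t; rewrite !mxE /=; field.
(* Differentiating twice along $e_1$ gives, up to scale,
   $\frac12\sin^2t+\frac52\cos^2t=\frac32+\cos2t$. *)
- have := hol_circleD (hol_circleZ (- (8 / 3)) (h2 (row2 1 0) (row2 1 0)))
    (hol_circleZ (- (3 / 2)) one).
  congr hol_circle; apply/funext => t; rewrite !mxE /= dbl cosD.
  by field: (sin2cos2 t).
(* The mixed derivative gives, up to scale, $(\frac52-\frac12)\sin t\cos t=\sin2t$. *)
- have := hol_circleZ (- (8 / 3)) (h2 (row2 0 1) (row2 1 0)).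
  congr hol_circle; apply/funext => t; rewrite !mxE /= dbl sinD.
  by field.
Qed.

Lemma hol_circle_trig (n : nat) :
  hol_circle (fun t => cos (n%:R * t)) /\ hol_circle (fun t => sin (n%:R * t)).
Proof.
have [h1 hc hs hc2 hs2] := hol_circle_low.
pose Q n := hol_circle (fun t => cos (n%:R * t)) /\
  hol_circle (fun t => sin (n%:R * t)).
(* Mode 2 belongs to the base case: the step divides by $m-1$, where $m$ is the highest mode already
   reached, so it cannot start from $m=1$. *)
suff : Q n /\ Q n.+1 /\ Q n.+2 by case.
elim: n => [|n [_ [[hcn hsn] [hcm hsm]]]].
  split; last split; split.
  - by under eq_fun do rewrite mul0r cos0.
  - by under eq_fun do rewrite mul0r sin0; exact: hol_circle0.
  - by under eq_fun do rewrite mul1r.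
  - by under eq_fun do rewrite mul1r.
  - exact: hc2.
  - exact: hs2.
split; [by [] | split; first by []].
pose m : R := n.+2%:R.
have m1 : 1 - m != 0.
  by rewrite subr_eq0 eq_sym /m -[X in _ != X]/(1%:R) eqr_nat.
have mS t : n.+3%:R * t = m * t + t by rewrite -natr1 mulrDl mul1r.
have mP t : n.+1%:R * t = m * t - t by rewrite /m -[n.+2%:R]natr1 mulrDl mul1r addrK.
have cd t : is_derive t 1 (@cos R) (- sin t) by exact: is_derive_cos.
have md t : is_derive t 1 (fun t : R => m * t) m by derive; ring.
have cmd t : is_derive t 1 (fun t : R => cos (m * t)) (- sin (m * t) * m).
  exact: is_derive1_comp (is_derive_cos _) (md t).
have smd t : is_derive t 1 (fun t : R => sin (m * t)) (cos (m * t) * m).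
  exact: is_derive1_comp (is_derive_sin _) (md t).
split.
(* $[\cos t\,\partial_t,\sin mt\,\partial_t]=\left(\frac{m-1}2\cos(m+1)t+\frac{m+1}2\cos(m-1)t\right)\partial_t$. *)
- have := hol_circleZ (2 / (m - 1)) (hol_circleD (hol_circle_bracket cd smd hc hsm)
    (hol_circleZ (- ((m + 1) / 2)) hcn)).
  congr hol_circle; apply/funext => t; rewrite mS mP cosB (cosD (m * t)).
  by field; rewrite -opprB oppr_eq0.
(* $[\cos t\,\partial_t,\cos mt\,\partial_t]=\left(\frac{1-m}2\sin(m+1)t-\frac{m+1}2\sin(m-1)t\right)\partial_t$. *)
- have := hol_circleZ (2 / (1 - m)) (hol_circleD (hol_circle_bracket cd cmd hc hcm)
    (hol_circleZ ((m + 1) / 2) hsn)).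
  congr hol_circle; apply/funext => t; rewrite mS mP sinB (sinD (m * t)).
  by field.
Qed.

Lemma hol_circle_witt f : witt_algebra f -> hol_circle f.
Proof.
move=> [N [a [b ->]]]; elim: N => [|N IHN].
  by under eq_fun do rewrite big_ord0; exact: hol_circle0.
under eq_fun do rewrite big_ord_recr.
apply: hol_circleD IHN _; have [hc hs] := hol_circle_trig N.
by apply: hol_circleD; exact: hol_circleZ.
Qed.

Lemma indicatrix0P y : indicatrix F 0 y -> exists t, y = circle_point t.
Proof.
move=> n1; have {n1} : F (0, y) = 1 := n1.
rewrite funkE /funk_disc /= !mxE !mul0r subrr expr0n subr0 !addr0
  subr0 divr1.
set a := y 0 0; set b := y 0 1 => n1.
have ab : a ^+ 2 + b ^+ 2 = 1.
  by rewrite -[LHS]sqr_sqrtr ?addr_ge0 ?sqr_ge0 // n1 expr1n.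
have a1 : -1 <= a <= 1 by apply/andP; split; nra.
have bE : `|b| = sin (acos a).
  by rewrite sin_acos // -ab addrAC subrr add0r sqrtr_sqr.
have aE : cos (acos a) = a by rewrite acosK // in_itv.
(* The arccosine only reaches the upper half circle; the lower half takes the opposite angle. *)
case: (leP 0 b) => b0.
  by exists (acos a); apply: row2P; rewrite -/a -/b // -bE ger0_norm.
exists (- acos a); apply: row2P; rewrite -/a -/b ?cosN //.
by rewrite sinN -bE ltr0_norm // opprK.
Qed.

End FunkSurface.
Unset Implicit Arguments.

Theorem theorem6p2 (R : realType) (f : R -> R) (hf : witt_algebra f) :
  exists2 eta : 'rV[R]_2 -> 'rV[R]_2,
    hol_star_at (@unit_ball R 2) (@funk R 2) 0 eta &
    forall t : R, eta (circle_point t) = f t *: circle_tangent t.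
Proof.
have [xi hxi xiE] := hol_circle_witt hf.
have xi1 t : xi (0, circle_point t) = (0, f t *: circle_tangent t).
  by rewrite -{1}[circle_point t]scale1r xiE // mul1r.
(* The fibre component of [xi] suffices: by [xi1] the base component vanishes over the unit circle,
   which is the whole indicatrix at $0$. *)
exists (fun y => (xi (0, y)).2); last by move=> t; rewrite xi1.
by exists xi => // y /indicatrix0P[t ->]; rewrite xi1.
Qed.
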